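(* Let $q\geq 3$. A first-order ordinary differential equation on the real line in normal form, $dx/dt=X(t,x)$, is (up to a local $t$-independent change of variables) an Abel equation of degree $q$ if and only if it can be considered as an element of the quasi-Lie family $\mathcal{V}$ of a quasi-Lie scheme $S(W,V)$ on $\mathbb{R}$ with $\dim W=2$ and $\dim V=q+1$.
   Context: An Abel equation (of the first kind) of degree $q\ge3$ is an equation $\frac{dx}{dt}=f_0(t)+f_1(t)x+\cdots+f_q(t)x^q$ with arbitrary $t$-dependent functions $f_0,\ldots,f_q$ (the function $f_q$ is not required to be nonzero). A local $t$-independent change of variables is a local diffeomorphism $x\mapsto\bar x=\varphi(x)$ of the real line. A quasi-Lie scheme $S(W,V)$ consists of two finite-dimensional real vector spaces $W,V$ of vector fields with $[W,W]\subset W\subset V$ and $[W,V]\subset V$. The quasi-Lie family $\mathcal{V}$ of $S(W,V)$ is the $C^\infty(\mathbb{R})$-module of $t$-dependent vector fields $X=\{X_t\}_{t\in\mathbb{R}}$ with $X_t\in V$ for every $t$. The differential equation $dx/dt=X(t,x)$ is identified with the $t$-dependent vector field $X(t,x)\,\partial/\partial x$.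
   Formalization: The scheme S(W,V) must also satisfy that an element of V vanishing near one point vanishes everywhere (automatic if analytic; false without it, by bump functions); scheme and change of variables live on one common open interval. *)

(* Defs.v *)
From HB Require Import structures.
From mathcomp Require Import all_boot all_order all_algebra.
From mathcomp Require Import all_classical all_reals all_analysis.

Set Implicit Arguments.
Unset Strict Implicit.
Unset Printing Implicit Defensive.

Import Order.TTheory GRing.Theory Num.Theory.
Import numFieldNormedType.Exports.

Local Open Scope ring_scope.
Local Open Scope classical_set_scope.

(* A vector field h(x) d/dx on an open interval I of the real line is
   represented by a total function h : R -> R of which only the values on I
   matter; a t-dependent vector field X(t,x) d/dx, identified with the equation
   dx/dt = X(t,x), by X : R -> R -> R (time first).  As in the usual definition
   of an Abel equation, the dependence on t is arbitrary.
   The interval I is the common domain of the equation, of the changes of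
   variables and of the schemes: I is the whole line for a scheme on R, and a
   neighbourhood of a point for a local change of variables at this point. *)

Definition open_interval (R : realType) (I : set R) : Prop :=
  [/\ open I, is_interval I & I !=set0].

Definition smooth_on (R : realType) (I : set R) (h : R -> R) : Prop :=
  forall (n : nat) (x : R), I x -> derivable (h^`(n)) x 1.

(* A smooth diffeomorphism from the open set I onto an open set: a local
   diffeomorphism of the real line with domain I. *)
Definition local_diffeo (R : realType) (I : set R) (phi : R -> R) : Prop :=
  [/\ smooth_on I phi, open (phi @` I) &
      exists psi : R -> R,
        smooth_on (phi @` I) psi /\ (forall x, I x -> psi (phi x) = x)].

(* dy/dt = Y(t,y), for y in phi(I), is the equation dx/dt = X(t,x), for x in I,
   written in the variable y = phi(x). *)
Definition transforms_into (R : realType) (I : set R) (phi : R -> R)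
    (X Y : R -> R -> R) : Prop :=
  forall t x, I x -> Y t (phi x) = (phi^`())%classic x * X t x.

Definition abel_equation (R : realType) (q : nat) (X : R -> R -> R) : Prop :=
  exists f : 'I_q.+1 -> R -> R,
    forall t x, X t x = \sum_(i < q.+1) f i t * x ^+ i.

Definition abel_up_to_change (R : realType) (q : nat) (I : set R)
    (X : R -> R -> R) : Prop :=
  exists (phi : R -> R) (Y : R -> R -> R),
    [/\ local_diffeo I phi, transforms_into I phi X Y & abel_equation q Y].

(* [f d/dx, g d/dx] = (f g' - g f') d/dx *)
Definition lie_bracket (R : realType) (f g : R -> R) : R -> R :=
  fun x => f x * (g^`())%classic x - g x * (f^`())%classic x.

(* Real vector spaces of smooth vector fields on I; the second clause says that
   V only depends on the values on I of its elements. *)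
Definition vf_space (R : realType) (I : set R) (V : set (R -> R)) : Prop :=
  [/\ forall h, V h -> smooth_on I h,
      forall h k, V h -> (forall x, I x -> h x = k x) -> V k,
      V (fun=> 0) &
      forall (a : R) h k, V h -> V k -> V (fun x => a * h x + k x)].

(* V has a basis with n elements, vector fields being compared on I. *)
Definition vf_dim (R : realType) (I : set R) (V : set (R -> R)) (n : nat) :
    Prop :=
  exists e : 'I_n -> R -> R,
    [/\ forall i, V (e i),
        forall c : 'I_n -> R,
          (forall x, I x -> \sum_(i < n) c i * e i x = 0) ->
          forall i, c i = 0 &
        forall h, V h -> exists c : 'I_n -> R,
          forall x, I x -> h x = \sum_(i < n) c i * e i x].

Definition quasi_Lie_scheme (R : realType) (I : set R) (W V : set (R -> R)) :
    Prop :=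
  [/\ vf_space I W /\ (exists m, vf_dim I W m),
      vf_space I V /\ (exists n, vf_dim I V n),
      W `<=` V,
      forall f g, W f -> W g -> W (lie_bracket f g) &
      forall f g, W f -> V g -> V (lie_bracket f g)].

Definition quasi_Lie_family (R : realType) (V : set (R -> R)) :
    set (R -> R -> R) :=
  [set X | forall t, V (X t)].

(* The elements of V are determined by their germ at any point of I, so that
   dimensions are the same on I and on each nonempty open subset of I (this is
   automatic for analytic vector fields).  In the smooth category, schemes
   without this property have to be excluded: if h_0, ..., h_q are nonzero
   smooth functions with disjoint compact supports, then W = <h_0, h_1> and
   V = <h_0, ..., h_q> satisfy all the bracket conditions (all the brackets
   vanish), but dx/dt = h_0(x) is not an Abel equation in any coordinate around
   a boundary point of the support of h_0. *)
Definition germ_determined (R : realType) (I : set R) (V : set (R -> R)) :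
    Prop :=
  forall h x, V h -> I x -> (\forall y \near x, h y = 0) ->
    forall y, I y -> h y = 0.

(* Main.v *)
Require Import Defs.
From HB Require Import structures.
From mathcomp Require Import all_boot all_order all_algebra.
From mathcomp Require Import all_classical all_reals all_analysis.
From mathcomp Require Import ring lra zify.

Set Implicit Arguments.
Unset Strict Implicit.
Unset Printing Implicit Defensive.

Import Order.TTheory GRing.Theory Num.Theory.
Import numFieldNormedType.Exports.

Local Open Scope ring_scope.
Local Open Scope classical_set_scope.

(* Write [x'] for derivatives and take [W] spanned by [w0, w1].  The bracket
   [f = [w0, w1]] is nonzero, since otherwise [w1] would be a multiple of [w0]
   near a point, hence everywhere.  Some [g] in [W] satisfies [[f, g] = f], so
   [ad f] is nilpotent on [V]; its kernel is the line of [f], so [ad f] is a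
   single Jordan block, and as [q >= 3] there are [v, w] in [V] with
   [[f, v] = 2 g], [[g, v] = v] and [[f, w] = 3 v].  These relations make a zero
   of [f] propagate to a neighbourhood, so [f] has no zero, and [phi = g / f] is
   a coordinate on [I], with [phi' = 1 / f].  In the coordinate [y = phi x], the
   field [f] is [d/dy], and the nilpotency of [ad f] turns [V] into the fields
   [p(y) d/dy] with [p] a polynomial of degree at most [q].  Conversely these
   fields, with [W] given by [deg p <= 1], form a scheme. *)

Section LinearAlgebra.
Variables (F : fieldType) (n : nat).
Implicit Types A B : 'M[F]_n.+1.

Lemma horner_mx_comm_deriv A B (p : {poly F}) :
  B * A = A * B + A ->
  B * horner_mx A p = horner_mx A p * B + horner_mx A (p^`() * 'X).
Proof.
move=> BA; elim/poly_ind: p => [|p c IH].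
  by rewrite deriv0 mul0r rmorph0 mulr0 mul0r addr0.
rewrite derivD derivM derivX derivC mulr1 addr0 mulrDl.
rewrite !rmorphD !rmorphM /= horner_mx_C horner_mx_X.
have cB : B * c%:M = c%:M * B by apply: scalar_mxC.
rewrite rmorphM /= horner_mx_X in IH.
rewrite mulrDr mulrDl cB mulrA IH !mulrDl -!mulrA BA !mulrDr -!addrA.
by congr (_ + _); rewrite addrC -!addrA [RHS]addrCA.
Qed.

(* The minimal polynomial [p] of [A] divides ['X * p'], hence is ['X^d]. *)
Lemma nilpotent_of_comm A B : [pchar F] =i pred0 ->
  B * A = A * B + A -> A ^+ n.+1 = 0.
Proof.
move=> F0 BA; set p := mxminpoly A.
have p0 : horner_mx A p = 0 := mx_root_minpoly A.
have := horner_mx_comm_deriv p BA.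
rewrite p0 mulr0 mul0r add0r => /esym/mxminpoly_min; rewrite -/p => dvd.
set d := degree_mxminpoly A.
have sp : size p = d.+1 := size_mxminpoly A.
have lp : p`_d = 1 by have /monicP := mxminpoly_monic A; rewrite /lead_coef sp.
have cE i : (p^`() * 'X - d%:R *: p)`_i = p`_i * (i%:R - d%:R).
  rewrite coefB coefMX coefZ coef_deriv mulrBr [d%:R * _]mulrC; congr (_ - _).
  by case: i => [|i] /=; rewrite ?mulr0// mulr_natr.
have q0 : p^`() * 'X - d%:R *: p = 0.
  apply/eqP; apply: contraT => q_neq0.
  have : p %| p^`() * 'X - d%:R *: p by rewrite dvdp_sub// -mul_polyC dvdp_mull.
  move=> /(dvdp_leq q_neq0); rewrite sp ltnNge; case/negP.
  apply/leq_sizeP => i; rewrite cE leq_eqVlt => /predU1P[<-|di].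
    by rewrite subrr mulr0.
  by rewrite nth_default ?mul0r// sp.
have pE : p = 'X^d.
  apply/polyP => i; rewrite coefXn; case: eqP => [->//|/eqP id].
  have /eqP := cE i; rewrite q0 coef0 eq_sym mulf_eq0 => /orP[/eqP//|].
  move: id; rewrite neq_ltn => /orP[id|id].
    rewrite -opprB -natrB 1?ltnW// oppr_eq0.
    by rewrite (pcharf0P F).1// subn_eq0 leqNgt id.
  by rewrite nth_default ?sp.
have Ad : A ^+ d = 0 by rewrite -p0 pE rmorphXn /= horner_mx_X.
have dn : (d <= n.+1)%N.
  have := dvdp_leq (monic_neq0 (char_poly_monic A)) (mxminpoly_dvd_char A).
  by rewrite -/p sp size_char_poly ltnS.
have -> : A ^+ n.+1 = A ^+ (n.+1 - d + d) by rewrite subnK.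
by rewrite exprD Ad mulr0.
Qed.

(* A nilpotent matrix with one-dimensional kernel is a single Jordan block. *)
Lemma submx_of_mulmx_exp A : A ^+ n.+1 = 0 -> \rank A = n ->
  forall v : 'rV_n.+1, v *m A ^+ n = 0 -> (v <= A)%MS.
Proof.
move=> An rA v vAn.
have rk k : (k <= n)%N -> (n.+1 - k <= \rank (A ^+ k))%N.
  elim: k => [|k IH] kn; first by rewrite subn0 expr0 mxrank1.
  have := mxrank_mul_ker (A ^+ k) A.
  have := mxrankS (capmxSr (A ^+ k) (kermx A)).
  rewrite mxrank_ker rA mulmxE -exprSr.
  have := IH (ltnW kn); lia.
have AK : (A <= kermx (A ^+ n))%MS by apply/sub_kermxP; rewrite mulmxE -exprS.
have : (kermx (A ^+ n) <= A)%MS.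
  rewrite -(geq_leqif (mxrank_leqif_sup AK)) mxrank_ker rA.
  have := rk n (leqnn n); lia.
by apply: submx_trans; apply/sub_kermxP.
Qed.

End LinearAlgebra.

Section Derive1.
Variable R : realType.
Implicit Types (f g h : R -> R) (x d : R).

Lemma derive1_is_derive f x : derivable f x 1 -> is_derive x 1 f (derive1 f x).
Proof. by move=> df; rewrite derive1E; exact: derivableP. Qed.

Lemma is_derive_derive1 f x d : is_derive x 1 f d -> derive1 f x = d.
Proof. by rewrite derive1E => df; exact: derive_val. Qed.

Lemma derive1D f g x : derivable f x 1 -> derivable g x 1 ->
  derive1 (f + g) x = derive1 f x + derive1 g x.
Proof.
move=> /derive1_is_derive df /derive1_is_derive dg.
exact: is_derive_derive1 (is_deriveD df dg).
Qed.

Lemma derive1B f g x : derivable f x 1 -> derivable g x 1 ->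
  derive1 (f - g) x = derive1 f x - derive1 g x.
Proof.
move=> /derive1_is_derive df /derive1_is_derive dg.
exact: is_derive_derive1 (is_deriveB df dg).
Qed.

Lemma derive1M f g x : derivable f x 1 -> derivable g x 1 ->
  derive1 (f * g) x = f x * derive1 g x + g x * derive1 f x.
Proof.
move=> /derive1_is_derive df /derive1_is_derive dg.
exact: is_derive_derive1 (is_deriveM df dg).
Qed.

Lemma derive1Z (a : R) f x : derivable f x 1 ->
  derive1 (cst a * f) x = a * derive1 f x.
Proof.
by move=> df; rewrite derive1M ?derive1_cst ?mulr0 ?addr0//; exact: derivable_cst.
Qed.

Lemma derive1V f x : f x != 0 -> derivable f x 1 ->
  derive1 (fun y => (f y)^-1) x = - (derive1 f x) / f x ^+ 2.
Proof.
move=> fx0 /derive1_is_derive df; rewrite (is_derive_derive1 (is_deriveV fx0 df)).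
by rewrite -[_ *: _]/(_ * _) mulrC mulrN mulNr.
Qed.

Lemma near_eq_derive1 f g x :
  (\forall y \near x, f y = g y) -> derive1 f x = derive1 g x.
Proof. by move=> fg; rewrite !derive1E; exact: near_eq_derive. Qed.

Lemma derive1_eq_on (I : set R) f g : open I -> (forall x, I x -> f x = g x) ->
  forall x, I x -> derive1 f x = derive1 g x.
Proof.
move=> oI fg x Ix; apply: near_eq_derive1.
by apply: filterS (open_nbhs_nbhs (conj oI Ix)) => y; exact: fg.
Qed.

Lemma derivable_eq_on (I : set R) f g : open I -> (forall x, I x -> f x = g x) ->
  forall x, I x -> derivable f x 1 -> derivable g x 1.
Proof.
move=> oI fg x Ix; apply: near_eq_derivable.
by apply: filterS (open_nbhs_nbhs (conj oI Ix)) => y; exact: fg.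
Qed.

Lemma derivable_cvg f x : derivable f x 1 -> f @ x --> f x.
Proof. by move=> df; exact/differentiable_continuous/derivable1_diffP. Qed.

Lemma MVT_is_interval (I : set R) f a b : is_interval I -> I a -> I b -> a < b ->
  (forall x, I x -> derivable f x 1) ->
  exists2 c, I c & f b - f a = derive1 f c * (b - a).
Proof.
move=> iI Ia Ib ab df.
have Iab x : x \in `[a, b]%R -> I x by rewrite in_itv /=; exact: iI.
have sub x : x \in `]a, b[%R -> I x by move=> /subset_itv_oo_cc; exact: Iab.
have fc : {within `[a, b], continuous f}.
  apply: continuous_in_subspaceT => x /set_mem xab.
  by apply/derivable_cvg/df/Iab.
have [c cab fab] := MVT ab (fun x xab => derive1_is_derive (df x (sub x xab))) fc.
by exists c => //; exact: sub.
Qed.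

Lemma derive1_eq0_cst (I : set R) f : is_interval I ->
  (forall x, I x -> derivable f x 1) -> (forall x, I x -> derive1 f x = 0) ->
  forall x y, I x -> I y -> f x = f y.
Proof.
move=> iI df f0 x y; wlog xy : x y / x <= y => [hw Ix Iy|].
  by case: (leP x y) => [|/ltW] xy; [|apply/esym]; apply: hw.
move: xy; rewrite le_eqVlt => /predU1P[->//|xy] Ix Iy.
have [c Ic] := MVT_is_interval iI Ix Iy xy df.
by rewrite f0// mul0r => /eqP; rewrite subr_eq0 => /eqP.
Qed.

Lemma derive1_neq0_inj (I : set R) f : is_interval I ->
  (forall x, I x -> derivable f x 1) ->
  (forall x, I x -> derive1 f x != 0) -> {in I &, injective f}.
Proof.
move=> iI df f0 x y /set_mem Ix /set_mem Iy fxy.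
have {f0} main a b : I a -> I b -> f a = f b -> ~ a < b.
  move=> Ia Ib fab ab; have [c Ic] := MVT_is_interval iI Ia Ib ab df.
  rewrite fab subrr => /esym/eqP; rewrite mulf_eq0 (negbTE (f0 _ Ic)) subr_eq0.
  by rewrite (gt_eqF ab).
have [/main|/main|//] := ltgtP x y; first by move=> /(_ Ix Iy fxy).
by move=> /(_ Iy Ix (esym fxy)).
Qed.

End Derive1.

Section SmoothOn.
Variables (R : realType) (I : set R).
Hypothesis oI : open I.
Implicit Types (f g h : R -> R).

Lemma smooth_on_coind (S : set (R -> R)) :
  (forall h, S h -> forall x, I x -> derivable h x 1) ->
  (forall h, S h -> exists2 k, S k & forall x, I x -> derive1 h x = k x) ->
  forall h, S h -> smooth_on I h.
Proof.
move=> Sd S' h Sh n.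
have [k Sk hk] : exists2 k, S k & forall x, I x -> derive1n n h x = k x.
  elim: n => [|n [k Sk hk]]; first by exists h.
  have [l Sl kl] := S' k Sk; exists l => // x Ix.
  by rewrite derive1nS (derive1_eq_on oI hk)// kl.
move=> x Ix; apply: (derivable_eq_on oI _ Ix (Sd k Sk x Ix)) => y Iy.
by rewrite hk.
Qed.

Lemma smooth_on_derivable h : smooth_on I h -> forall x, I x -> derivable h x 1.
Proof. exact: (@^~ 0%N). Qed.

Lemma smooth_on_derive1 h : smooth_on I h -> smooth_on I (derive1 h).
Proof. by move=> sh n x Ix; rewrite -derive1Sn; exact: sh. Qed.

(* This class is stable under derivation, so one coinduction gives the closure of
   smooth functions under all its operations. *)
Inductive smooth_expr : set (R -> R) :=
| SmoothAtom f of smooth_on I f : smooth_expr f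
| SmoothAdd f g of smooth_expr f & smooth_expr g : smooth_expr (f + g)
| SmoothMul f g of smooth_expr f & smooth_expr g : smooth_expr (f * g)
| SmoothInv f of smooth_expr f & (forall x, I x -> f x != 0) :
    smooth_expr (fun x => (f x)^-1).

Lemma smooth_expr_derivable f : smooth_expr f -> forall x, I x -> derivable f x 1.
Proof.
elim=> {f} [f sf|f g _ df _ dg|f g _ df _ dg|f _ df f0] x Ix.
- exact: smooth_on_derivable.
- by apply: derivableD; [exact: df|exact: dg].
- by apply: derivableM; [exact: df|exact: dg].
- by apply: derivableV; [exact: f0|exact: df].
Qed.

Lemma smooth_expr_smooth f : smooth_expr f -> smooth_on I f.
Proof.
apply: smooth_on_coind => {f} f; first exact: smooth_expr_derivable.
elim=> {f} [f sf|f g ef [f' ef' fE] eg [g' eg' gE]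
  |f g ef [f' ef' fE] eg [g' eg' gE]|f ef [f' ef' fE] f0].
- by exists (derive1 f) => //; exact/SmoothAtom/smooth_on_derive1.
- exists (f' + g'); first exact: SmoothAdd.
  by move=> x Ix; rewrite derive1D ?fE ?gE//; exact: smooth_expr_derivable.
- exists (f * g' + g * f'); first by apply: SmoothAdd; exact: SmoothMul.
  by move=> x Ix; rewrite derive1M ?fE ?gE//; exact: smooth_expr_derivable.
- exists (f' * (cst (-1) * ((fun x => (f x)^-1) * (fun x => (f x)^-1)))).
    apply: SmoothMul => //; apply: SmoothMul; last first.
      by apply: SmoothMul; exact: SmoothInv.
    apply/SmoothAtom/(@smooth_on_coind (range cst)); last by exists (-1).
      by move=> _ [a _ <-] x _; exact: derivable_cst.
    by move=> _ [a _ <-]; exists (cst 0); [exists 0|move=> x _; exact: derive1_cst].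
  move=> x Ix; rewrite derive1V ?fE ?f0//; last exact: smooth_expr_derivable.
  by rewrite mulNr -mulrN -[RHS]/(_ * (-1 * (_ * _))) mulN1r expr2 invfM.
Qed.

Lemma smooth_onD f g : smooth_on I f -> smooth_on I g -> smooth_on I (f + g).
Proof. by move=> sf sg; apply/smooth_expr_smooth/SmoothAdd; exact: SmoothAtom. Qed.

Lemma smooth_onM f g : smooth_on I f -> smooth_on I g -> smooth_on I (f * g).
Proof. by move=> sf sg; apply/smooth_expr_smooth/SmoothMul; exact: SmoothAtom. Qed.

Lemma smooth_onV f : smooth_on I f -> (forall x, I x -> f x != 0) ->
  smooth_on I (fun x => (f x)^-1).
Proof.
by move=> sf f0; apply/smooth_expr_smooth/SmoothInv => //; exact: SmoothAtom.
Qed.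

Lemma smooth_on_cst a : smooth_on I (cst a).
Proof.
apply: (@smooth_on_coind (range cst)); last by exists a.
  by move=> _ [b _ <-] x _; exact: derivable_cst.
by move=> _ [b _ <-]; exists (cst 0); [exists 0|move=> x _; exact: derive1_cst].
Qed.

Lemma smooth_on_id : smooth_on I id.
Proof.
apply: (@smooth_on_coind [set h | h = id \/ exists a, h = cst a]); last by left.
  by move=> _ [->|[a ->]] x _; [exact: derivable_id|exact: derivable_cst].
move=> _ [->|[a ->]].
  by exists (cst 1); [right; exists 1|move=> x _; exact: derive1_id].
by exists (cst 0); [right; exists 0|move=> x _; exact: derive1_cst].
Qed.

Lemma smooth_on_eq f g : smooth_on I f -> (forall x, I x -> f x = g x) -> smooth_on I g.
Proof.
move=> sf fg; apply: (@smooth_on_coind [set h | exists2 k, smooth_on I k &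
  forall x, I x -> k x = h x]); last by exists f.
  move=> h [k sk kh] x Ix; apply: (derivable_eq_on oI kh Ix).
  exact: smooth_on_derivable.
move=> h [k sk kh]; exists (derive1 k).
  by exists (derive1 k) => //; exact: smooth_on_derive1.
by move=> x Ix; rewrite (derive1_eq_on oI kh).
Qed.

Lemma smooth_on_horner phi (p : {poly R}) : smooth_on I phi ->
  smooth_on I (fun x => p.[phi x]).
Proof.
move=> sphi; elim/poly_ind: p => [|p c IH].
  by refine (smooth_on_eq (@smooth_on_cst 0) _) => x _; rewrite horner0.
refine (smooth_on_eq (smooth_onD (smooth_onM IH sphi) (@smooth_on_cst c)) _) => x _.
by rewrite !hornerE.
Qed.

End SmoothOn.

Section LieBracket.
Variable R : realType.
Implicit Types (f g h phi : R -> R) (x : R).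

Lemma lie_bracketC f g : lie_bracket f g = - lie_bracket g f.
Proof. by apply/funext => x; rewrite /lie_bracket !fctE opprB. Qed.

Lemma lie_bracket_eq_on (I : set R) f f1 g g1 : open I ->
  (forall x, I x -> f x = f1 x) -> (forall x, I x -> g x = g1 x) ->
  forall x, I x -> lie_bracket f g x = lie_bracket f1 g1 x.
Proof.
move=> oI ff1 gg1 x Ix; rewrite /lie_bracket ff1// gg1//.
by rewrite (derive1_eq_on oI ff1)// (derive1_eq_on oI gg1).
Qed.

Lemma is_derive_horner_comp (p : {poly R}) phi x : derivable phi x 1 ->
  is_derive x 1 (fun y => p.[phi y]) (p^`().[phi x] * derive1 phi x).
Proof. by move=> /derive1_is_derive dphi; exact: is_derive1_comp. Qed.

Lemma lie_bracket_horner (p r : {poly R}) phi f x :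
  derivable phi x 1 -> derivable f x 1 -> derive1 phi x * f x = 1 ->
  lie_bracket (fun y => p.[phi y] * f y) (fun y => r.[phi y] * f y) x =
  (p * r^`() - r * p^`()).[phi x] * f x.
Proof.
move=> dphi df phif; have dh s := is_derive_horner_comp s dphi.
rewrite /lie_bracket.
rewrite (derive1M (@ex_derive _ _ _ _ _ _ _ (dh p)) df).
rewrite (derive1M (@ex_derive _ _ _ _ _ _ _ (dh r)) df).
rewrite !(is_derive_derive1 (dh _)) hornerD hornerN !hornerM.
by rewrite -[RHS]mulr1 -phif; ring.
Qed.

End LieBracket.

Section PolynomialFields.
Variables (R : realType) (I : set R) (phi f : R -> R).
Hypothesis oI : open I.
Hypotheses (sphi : smooth_on I phi) (sf : smooth_on I f).
Hypothesis phif : forall x, I x -> derive1 phi x * f x = 1.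

(* In the coordinate [y = phi x], the fields [p(y) d/dy] with [size p <= n]. *)
Definition poly_fields (n : nat) : set (R -> R) :=
  [set h | exists2 p : {poly R}, (size p <= n)%N &
    forall x, I x -> h x = p.[phi x] * f x].

Lemma straightening_neq0 x : I x -> f x != 0.
Proof.
move=> Ix; apply: contraPneq (phif Ix) => ->.
by apply/eqP; rewrite mulr0 eq_sym oner_eq0.
Qed.

Lemma horner_comp_near_eq0 (p : {poly R}) x : I x ->
  (\forall y \near x, p.[phi y] = 0) -> p = 0.
Proof.
move=> Ix; have [n] := ubnP (size p); elim: n => // n IH in p *.
rewrite ltnS => sp p0.
have dp0 : deriv p = 0.
  have [->|p_neq0] := eqVneq p 0; first exact: deriv0.
  apply: IH; first exact: leq_trans (lt_size_deriv p_neq0) sp.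
  have Inear : \forall y \near x, I y by apply: open_nbhs_nbhs.
  apply: filterS2 (near_join p0) Inear => y py Iy.
  have /(smooth_on_derivable sphi) dphi := Iy.
  have := is_derive_derive1 (is_derive_horner_comp p dphi).
  rewrite (near_eq_derive1 py) derive1_cst => /esym/eqP.
  rewrite mulf_eq0 => /orP[/eqP//|/eqP phi0].
  by have := phif Iy; rewrite phi0 mul0r => /eqP; rewrite eq_sym oner_eq0.
have : (size p <= 1)%N.
  apply/leq_sizeP => -[//|i] _; have : (deriv p)`_i = 0 by rewrite dp0 coef0.
  by rewrite coef_deriv => /eqP; rewrite mulrn_eq0 => /eqP.
move=> /size1_polyC pE; have := nbhs_singleton p0; rewrite pE /= hornerC.
by move=> ->; rewrite polyC0.
Qed.

Lemma horner_field_near_eq0 (p : {poly R}) x : I x ->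
  (\forall y \near x, p.[phi y] * f y = 0) -> p = 0.
Proof.
move=> Ix p0; apply: (horner_comp_near_eq0 Ix).
have Inear : \forall y \near x, I y by apply: open_nbhs_nbhs.
apply: filterS2 p0 Inear => y /eqP + /straightening_neq0 fy.
by rewrite mulf_eq0 (negbTE fy) orbF => /eqP.
Qed.

Lemma poly_fields_vf_space n : vf_space I (poly_fields n).
Proof.
split.
- move=> h [p _ hE].
  refine (smooth_on_eq oI (smooth_onM oI (smooth_on_horner oI sphi) sf) _) => x Ix.
  by rewrite hE.
- by move=> h k [p sp hE] hk; exists p => // x Ix; rewrite -hk// hE.
- by exists 0; rewrite ?size_poly0// => x _; rewrite horner0 mul0r.
- move=> a h k [p sp hE] [r sr kE]; exists (a *: p + r).
    rewrite (leq_trans (size_polyD _ _))// geq_max sr andbT.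
    exact: leq_trans (size_scale_leq _ _) sp.
  by move=> x Ix; rewrite hE// kE// hornerD hornerZ mulrDl mulrA.
Qed.

Lemma poly_fields_vf_dim n : I !=set0 -> vf_dim I (poly_fields n) n.
Proof.
move=> [x0 Ix0]; exists (fun i x => phi x ^+ i * f x).
have sumE (c : 'I_n -> R) x : \sum_(i < n) c i * (phi x ^+ i * f x) =
    (\sum_(i < n) c i *: 'X^i).[phi x] * f x.
  rewrite horner_sum mulr_suml; apply: eq_bigr => i _.
  by rewrite hornerZ hornerXn mulrA.
split.
- move=> i; exists 'X^i; first by rewrite size_polyXn.
  by move=> x _; rewrite hornerXn.
- move=> c c0 i.
  have p0 : \sum_(i < n) c i *: 'X^i = 0.
    apply: (horner_field_near_eq0 Ix0).
    have Inear : \forall y \near x0, I y by apply: open_nbhs_nbhs.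
    by apply: filterS Inear => y Iy; rewrite -sumE c0.
  have := congr1 (fun p : {poly R} => p`_i) p0; rewrite coef0 coef_sum => <-.
  rewrite (bigD1 i)//= coefZ coefXn eqxx mulr1 big1 ?addr0// => j ji.
  by rewrite coefZ coefXn eq_sym -[nat_of_ord j == i]/(j == i) (negbTE ji) mulr0.
- move=> h [p sp hE]; exists (fun i => p`_i) => x Ix; rewrite sumE hE//.
  congr (_.[_] * _); apply/polyP => i; rewrite coef_sum.
  under eq_bigr do rewrite coefZ coefXn.
  have [ni|ni] := leqP n i.
    rewrite nth_default ?(leq_trans sp)// big1// => j _.
    by rewrite gtn_eqF ?mulr0// (leq_trans (ltn_ord j)).
  rewrite (bigD1 (Ordinal ni))//= eqxx mulr1 big1 ?addr0// => j ji.
  by rewrite eq_sym -[nat_of_ord j == i]/(j == Ordinal ni) (negbTE ji) mulr0.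
Qed.

Lemma poly_fields_germ_determined n : germ_determined I (poly_fields n).
Proof.
move=> h x [p _ hE] Ix h0 y Iy; rewrite hE//.
suff -> : p = 0 by rewrite horner0 mul0r.
apply: (horner_field_near_eq0 Ix).
have Inear : \forall y \near x, I y by apply: open_nbhs_nbhs.
by apply: filterS2 h0 Inear => z hz Iz; rewrite -hE.
Qed.

Lemma poly_fields_sub m n : (m <= n)%N -> poly_fields m `<=` poly_fields n.
Proof. by move=> mn h [p sp hE]; exists p => //; exact: leq_trans mn. Qed.

Lemma poly_fields_bracket n g h : (2 <= n)%N ->
  poly_fields 2 g -> poly_fields n h -> poly_fields n (lie_bracket g h).
Proof.
move=> n2 [p sp gE] [r sr hE]; exists (p * r^`() - r * p^`()).
  have [->|p0] := eqVneq p 0; first by rewrite deriv0 mul0r mulr0 subrr size_poly0.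
  have [->|r0] := eqVneq r 0; first by rewrite deriv0 mul0r mulr0 subrr size_poly0.
  have := lt_size_deriv p0; have := lt_size_deriv r0 => dr dp.
  rewrite (leq_trans (size_polyD _ _))// size_polyN geq_max.
  have le_pred_addn a b c : (a <= b)%N -> (c < 2)%N -> (b <= n)%N ->
    ((a + c).-1 <= n)%N by lia.
  have lt_pred_addn a b c : (a <= 2)%N -> (c < b)%N -> (b <= n)%N ->
    ((a + c).-1 <= n)%N by lia.
  rewrite !(leq_trans (size_polyMleq _ _))//.
    exact: le_pred_addn (leqnn _) (leq_trans dp sp) sr.
  exact: lt_pred_addn sp dr sr.
move=> x Ix; rewrite (lie_bracket_eq_on oI gE hE)//.
have [dphi df] := (smooth_on_derivable sphi Ix, smooth_on_derivable sf Ix).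
exact: lie_bracket_horner (phif Ix).
Qed.

End PolynomialFields.

Lemma abel_quasi_Lie (R : realType) (q : nat) (I : set R) (X : R -> R -> R) :
  (3 <= q)%N -> open_interval I -> abel_up_to_change q I X ->
  exists W V : set (R -> R),
    [/\ quasi_Lie_scheme I W V, vf_dim I W 2, vf_dim I V q.+1,
        germ_determined I V & quasi_Lie_family V X].
Proof.
move=> q3 [oI iI I0] [phi [Y [[sphi ophiI [psi [spsi psiK]]] XY [c YE]]]].
have dphi0 x : I x -> derive1 phi x != 0.
  move=> Ix; have dphi := derive1_is_derive (smooth_on_derivable sphi Ix).
  have dpsi : is_derive (phi x) 1 psi (derive1 psi (phi x)).
    by apply/derive1_is_derive/(smooth_on_derivable spsi); exists x.
  have := is_derive_derive1 (is_derive1_comp dpsi dphi).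
  rewrite (derive1_eq_on oI psiK Ix) derive1_id => /eqP.
  by apply: contraTneq => ->; rewrite mulr0 oner_eq0.
pose f x := (derive1 phi x)^-1.
have sf : smooth_on I f by apply: smooth_onV => //; exact: smooth_on_derive1.
have phif x : I x -> derive1 phi x * f x = 1 by move=> Ix; rewrite mulfV// dphi0.
have q2 : (2 <= q.+1)%N by rewrite ltnS ltnW// ltnW.
have dimV n : vf_dim I (poly_fields I phi f n) n by exact: poly_fields_vf_dim.
have spaceV n : vf_space I (poly_fields I phi f n) by exact: poly_fields_vf_space.
exists (poly_fields I phi f 2), (poly_fields I phi f q.+1); split => //.
- split.
  + by split=> //; exists 2%N.
  + by split=> //; exists q.+1.
  + exact: poly_fields_sub.
  + by move=> g h; exact: poly_fields_bracket.
  + by move=> g h; exact: poly_fields_bracket.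
- exact: poly_fields_germ_determined.
- move=> t; exists (\poly_(i < q.+1) c (inord i) t); first exact: size_poly.
  move=> x Ix; rewrite horner_poly.
  under eq_bigr do rewrite inord_val.
  by rewrite -YE XY// mulrC mulrA [f x * _]mulrC phif// mul1r.
Qed.

Section LieBracketAlgebra.
Variable R : realType.
Implicit Types (f g h k phi : R -> R) (x a : R).

Lemma derive1_lin a h k x : derivable h x 1 -> derivable k x 1 ->
  derive1 (fun y => a * h y + k y) x = a * derive1 h x + derive1 k x.
Proof.
move=> dh dk; have -> : (fun y => a * h y + k y) = cst a * h + k by [].
have dah : derivable (cst a * h) x 1 by exact: derivableM (derivable_cst a x 1) dh.
by rewrite [LHS]derive1D// derive1Z.
Qed.

Lemma derive1_lie_bracket f g x :
  derivable f x 1 -> derivable (derive1 f) x 1 ->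
  derivable g x 1 -> derivable (derive1 g) x 1 ->
  derive1 (lie_bracket f g) x =
    f x * derive1 (derive1 g) x - g x * derive1 (derive1 f) x.
Proof.
move=> df ddf dg ddg.
have -> : lie_bracket f g = f * derive1 g - g * derive1 f by [].
rewrite [LHS](derive1B (derivableM df ddg) (derivableM dg ddf)).
rewrite (derive1M df ddg) (derive1M dg ddf).
move: (derive1 (derive1 g) x) (derive1 (derive1 f) x) => g2 f2.
by move: (derive1 f x) (derive1 g x) => f1 g1; ring.
Qed.

Lemma lie_bracket_jacobi f g h x :
  derivable f x 1 -> derivable (derive1 f) x 1 ->
  derivable g x 1 -> derivable (derive1 g) x 1 ->
  derivable h x 1 -> derivable (derive1 h) x 1 ->
  lie_bracket f (lie_bracket g h) x =
    lie_bracket (lie_bracket f g) h x + lie_bracket g (lie_bracket f h) x.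
Proof.
move=> df ddf dg ddg dh ddh.
have E k l : lie_bracket k l x = k x * derive1 l x - l x * derive1 k x by [].
rewrite (E f (lie_bracket g h)) (E (lie_bracket f g) h) (E g (lie_bracket f h)).
rewrite (derive1_lie_bracket dg ddg dh ddh) (derive1_lie_bracket df ddf dg ddg).
rewrite (derive1_lie_bracket df ddf dh ddh) (E g h) (E f g) (E f h).
move: (derive1 (derive1 f) x) (derive1 (derive1 g) x) (derive1 (derive1 h) x).
by move: (derive1 f x) (derive1 g x) (derive1 h x) => *; ring.
Qed.

Lemma lie_bracketBr f g h x : derivable g x 1 -> derivable h x 1 ->
  lie_bracket f (g - h) x = lie_bracket f g x - lie_bracket f h x.
Proof.
move=> dg dh; rewrite /lie_bracket (derive1B dg dh) -[(g - h) x]/(g x - h x).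
by move: (derive1 f x) (derive1 g x) (derive1 h x) => *; ring.
Qed.

Lemma lie_bracket_sumr n g (c : 'I_n -> R) (e : 'I_n -> R -> R) x :
  (forall i, derivable (e i) x 1) ->
  lie_bracket g (fun y => \sum_(i < n) c i * e i y) x =
    \sum_(i < n) c i * lie_bracket g (e i) x.
Proof.
move=> de.
have -> : (fun y => \sum_(i < n) c i * e i y) = \sum_(i < n) (cst (c i) * e i).
  by apply/funext => y; rewrite fct_sumE.
have dce i : is_derive x 1 (cst (c i) * e i) (c i * derive1 (e i) x).
  rewrite -derive1Z//; apply: derive1_is_derive.
  exact: derivableM (derivable_cst (c i) x 1) (de i).
rewrite /lie_bracket (is_derive_derive1 (is_derive_sum dce)) fct_sumE.
rewrite mulr_sumr mulr_suml -sumrB; apply: eq_bigr => i _.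
rewrite -[(cst (c i) * e i) x]/(c i * e i x).
by move: (derive1 g x) (derive1 (e i) x) => *; ring.
Qed.

Lemma lie_bracket_eq0 (J : set R) f h : is_interval J -> J !=set0 ->
  (forall x, J x -> derivable f x 1) -> (forall x, J x -> derivable h x 1) ->
  (forall x, J x -> f x != 0) -> (forall x, J x -> lie_bracket f h x = 0) ->
  exists a, forall x, J x -> h x = a * f x.
Proof.
move=> iJ [x0 Jx0] df dh f0 fh0; pose u := h * (fun x => (f x)^-1).
have dV x : J x -> derivable (fun x => (f x)^-1) x 1.
  by move=> Jx; apply: derivableV; [exact: f0|exact: df].
have du x : J x -> derivable u x 1.
  by move=> Jx; apply: derivableM; [exact: dh|exact: dV].
exists (u x0) => x Jx; rewrite (derive1_eq0_cst iJ du _ Jx0 Jx).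
  by rewrite /u fctE divfK// f0.
move=> y Jy; rewrite derive1M; [|exact: dh|exact: dV].
rewrite derive1V; [|exact: f0|exact: df].
have /= := fh0 y Jy; rewrite /lie_bracket => fhy.
have fy := f0 y Jy.
suff -> : h y * (- derive1 f y / f y ^+ 2) + (f y)^-1 * derive1 h y =
  (f y * derive1 h y - h y * derive1 f y) / f y ^+ 2 by rewrite fhy mul0r.
by move: (derive1 f y) (derive1 h y) => *; field.
Qed.

End LieBracketAlgebra.

Section VectorFieldSpaces.
Variables (R : realType) (I : set R) (V : set (R -> R)).
Hypotheses (oI : open I) (spaceV : vf_space I V).
Implicit Types (f g h : R -> R).

Lemma vf_space_sum n (c : 'I_n -> R) (e : 'I_n -> R -> R) :
  (forall i, V (e i)) -> V (fun x => \sum_(i < n) c i * e i x).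
Proof.
case: spaceV => _ _ V0 VD; elim: n c e => [|n IH] c e Ve.
  by under eq_fun do rewrite big_ord0.
under eq_fun do rewrite big_ord_recl.
exact: VD (Ve _) (IH _ _ (fun i => Ve (lift ord0 i))).
Qed.

Lemma vf_space_derivable h x : V h -> I x -> derivable h x 1.
Proof. by move=> Vh; apply: smooth_on_derivable; case: spaceV => + _ _ _; apply. Qed.

Lemma germ_determined_centralizer f h x0 : germ_determined I V ->
  V f -> V h -> I x0 -> f x0 != 0 -> (forall x, I x -> lie_bracket f h x = 0) ->
  exists a, forall x, I x -> h x = a * f x.
Proof.
move=> germV Vf Vh Ix0 fx0 fh0.
have : \forall x \near x0, I x /\ f x != 0.
  apply: filterI; first exact: open_nbhs_nbhs.
  have fcont := derivable_cvg (vf_space_derivable Vf Ix0).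
  exact: fcont (open_nbhs_nbhs (conj (@open_neq _ _) fx0)).
move=> /nbhs_ballP[e /= e0]; rewrite ball_itv => ball_sub.
have sub x : [set` `]x0 - e, x0 + e[%R] x -> I x by move=> /ball_sub[].
have [||||||a ha] := @lie_bracket_eq0 R [set` `]x0 - e, x0 + e[%R] f h.
- exact: interval_is_interval.
- by exists x0; rewrite /= in_itv /= ltrBlDr ltrDl e0.
- by move=> x /sub; exact: vf_space_derivable.
- by move=> x /sub; exact: vf_space_derivable.
- by move=> x /ball_sub[].
- by move=> x /sub; exact: fh0.
have Vk : V (fun x => - a * f x + h x) by case: spaceV => _ _ _; apply.
exists a => x Ix; apply/eqP; rewrite -subr_eq0 addrC -mulNr; apply/eqP.
apply: (germV _ _ Vk Ix0) => //; apply/nbhs_ballP; exists e => //=.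
by rewrite ball_itv => y /ha ->; rewrite mulNr addNr.
Qed.

End VectorFieldSpaces.

Lemma deriv_surjective (F : numFieldType) (p : {poly F}) n : (size p <= n)%N ->
  exists2 r : {poly F}, (size r <= n.+1)%N & deriv r = p.
Proof.
move=> sp; exists (\poly_(i < n.+1) (p`_i.-1 / i%:R)); first exact: size_poly.
apply/polyP => i; rewrite coef_deriv coef_poly ltnS /=.
have [_|ni] := leqP i.+1 n; first by rewrite -[LHS]mulr_natr divfK// pnatr_eq0.
by rewrite mul0rn nth_default// (leq_trans sp).
Qed.

Lemma derive1_lie_bracket_eq0 (R : realType) (I : set R) (h k : R -> R) x :
  smooth_on I h -> smooth_on I k -> I x -> h x = 0 -> k x = 0 ->
  derive1 (lie_bracket h k) x = 0.
Proof.
move=> sh sk Ix hx kx.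
have [dh dk] := (smooth_on_derivable sh Ix, smooth_on_derivable sk Ix).
have ddh := smooth_on_derivable (smooth_on_derive1 sh) Ix.
have ddk := smooth_on_derivable (smooth_on_derive1 sk) Ix.
apply: etrans (derive1_lie_bracket dh ddh dk ddk) _; rewrite hx kx.
by move: (derive1 (derive1 k) x) (derive1 (derive1 h) x) => *; rewrite !mul0r subrr.
Qed.

Section NonVanishing.
Variables (R : realType) (I : set R).
Hypothesis oI : open I.

(* A field [f] that vanishes at [x0] forces [f], [g], [v] and their derivatives
   to vanish at [x0], and the first three relations are then contracting near
   [x0].  The field [w] excludes the scheme [<x d/dx, x ^ 2 d/dx>], for which
   [f = - x ^ 2], [g = - x] and [v = -1]. *)
Lemma lie_bracket_vanishing (f g v w : R -> R) x0 :
  smooth_on I f -> smooth_on I g -> smooth_on I v -> smooth_on I w ->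
  (forall x, I x -> lie_bracket f g x = f x) ->
  (forall x, I x -> lie_bracket f v x = 2 * g x) ->
  (forall x, I x -> lie_bracket g v x = v x) ->
  (forall x, I x -> lie_bracket f w x = 3 * v x) ->
  I x0 -> f x0 = 0 -> \forall x \near x0, f x = 0.
Proof.
move=> sf sg sv sw fg fv gv fw Ix0 fx0.
have [df dg] := (smooth_on_derivable sf, smooth_on_derivable sg).
have dv := smooth_on_derivable sv.
have ddf := smooth_on_derivable (smooth_on_derive1 sf).
have ddg := smooth_on_derivable (smooth_on_derive1 sg).
have ddv := smooth_on_derivable (smooth_on_derive1 sv).
have lie_bracketE (h k : R -> R) x :
    lie_bracket h k x = h x * derive1 k x - k x * derive1 h x.
  by [].
have [gx0 vx0] : g x0 = 0 /\ v x0 = 0.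
  move: (fg _ Ix0) (fv _ Ix0) (gv _ Ix0) (fw _ Ix0); rewrite !lie_bracketE fx0.
  move: (derive1 f x0) (derive1 g x0) (derive1 v x0) (derive1 w x0).
  move: (g x0) (v x0) (w x0) => g0 v0 w0 f1 g1 v1 w1 E1 E2 E3 E4.
  have [f10|f10] := eqVneq f1 0.
    by rewrite f10 in E2 E4; split; lra.
  have g0E : g0 = 0.
    apply/eqP; rewrite -(mulIr_eq0 _ (mulIf f10)); apply/eqP; lra.
  split=> //; apply/eqP; rewrite -(mulIr_eq0 _ (mulIf f10)); apply/eqP.
  by rewrite g0E in E2; lra.
have f'x0 : derive1 f x0 = 0.
  rewrite -(derive1_eq_on oI fg Ix0).
  exact: derive1_lie_bracket_eq0 Ix0 _ _.
have g'x0 : derive1 g x0 = 0.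
  have : derive1 (cst 2 * g) x0 = 0.
    rewrite -(derive1_eq_on oI fv Ix0).
    exact: derive1_lie_bracket_eq0 Ix0 _ _.
  by rewrite derive1Z; [move/eqP; rewrite mulf_eq0 pnatr_eq0 => /eqP|exact: dg].
have v'x0 : derive1 v x0 = 0.
  rewrite -(derive1_eq_on oI gv Ix0).
  exact: derive1_lie_bracket_eq0 Ix0 _ _.
have small (h : R -> R) : derivable (derive1 h) x0 1 -> derive1 h x0 = 0 ->
    \forall x \near x0, `|derive1 h x| < 4^-1.
  move=> ddh h0; have := derivable_cvg ddh; rewrite h0 => h'0.
  by apply: (cvgr0_norm_lt (derive1 h) h'0); rewrite invr_gt0.
have Inear : \forall x \near x0, I x by apply: open_nbhs_nbhs.
near=> x; have Ix : I x by near: x.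
have f1 : `|derive1 f x| < 4^-1 by near: x; exact: small (ddf _ Ix0) f'x0.
have g1 : `|derive1 g x| < 4^-1 by near: x; exact: small (ddg _ Ix0) g'x0.
have v1 : `|derive1 v x| < 4^-1 by near: x; exact: small (ddv _ Ix0) v'x0.
have bound (h k : R -> R) y (h1 : `|derive1 h y| < 4^-1) (k1 : `|derive1 k y| < 4^-1) :
    4 * `|lie_bracket h k y| <= `|h y| + `|k y|.
  have := ler_normB (h y * derive1 k y) (k y * derive1 h y).
  rewrite !normrM lie_bracketE.
  have := ler_wpM2l (normr_ge0 (h y)) (ltW k1).
  have := ler_wpM2l (normr_ge0 (k y)) (ltW h1).
  move: (`|h y|) (`|k y|) => *; lra.
have := bound f g x f1 g1; have := bound f v x f1 v1; have := bound g v x g1 v1.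
rewrite fg// fv// gv// normrM ger0_norm// => b1 b2 b3; apply/eqP.
rewrite -normr_le0; have := normr_ge0 (g x); have := normr_ge0 (v x).
move: (`|f x|) (`|g x|) (`|v x|) b1 b2 b3 => *; lra.
Unshelve. all: by end_near. Qed.

End NonVanishing.

Lemma smooth_local_diffeo (R : realType) (I : set R) (phi f : R -> R) :
  open I -> is_interval I -> smooth_on I phi -> smooth_on I f ->
  (forall x, I x -> derive1 phi x * f x = 1) -> local_diffeo I phi.
Proof.
move=> oI iI sphi sf phif.
have dphi := smooth_on_derivable sphi.
have phi'0 x : I x -> derive1 phi x != 0.
  move=> Ix; apply: contraPneq (phif _ Ix) => ->.
  by apply/eqP; rewrite mul0r eq_sym oner_eq0.
have phi_inj := derive1_neq0_inj iI dphi phi'0.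
pose psi y := xget 0 [set x | I x /\ phi x = y].
have psiP x : I x -> I (psi (phi x)) /\ phi (psi (phi x)) = phi x.
  by move=> Ix; rewrite /psi; case: xgetP => [_ -> //|/(_ x)[]].
have psiK x : I x -> psi (phi x) = x.
  by move=> Ix; have [Ipsi] := psiP x Ix; apply: phi_inj; exact: mem_set.
have Inear x : I x -> \forall y \near x, I y by move=> Ix; apply: open_nbhs_nbhs.
have near_psiK x : I x -> {near x, cancel phi psi}.
  by move=> Ix; apply: filterS (Inear x Ix) => y /psiK.
have near_cont x : I x -> {near x, continuous phi}.
  by move=> Ix; apply: filterS (Inear x Ix) => y /dphi; exact: derivable_cvg.
have ophiI : open (phi @` I).
  rewrite openE => _ [x Ix <-].
  have phiK := near_continuous_can_sym (near_cont x Ix) (near_psiK x Ix).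
  have psi_cont := near_can_continuous (near_psiK x Ix) (near_cont x Ix).
  have Ipsi : \forall y \near phi x, I (psi y).
    apply: (nbhs_singleton psi_cont); rewrite psiK//; exact: Inear.
  by apply: filterS2 phiK Ipsi => y phiy Iy; exists (psi y).
have dpsi x : I x -> is_derive (phi x) 1 psi (f x).
  move=> Ix; have -> : f x = (derive1 phi x)^-1.
    by rewrite -[LHS](mulKf (phi'0 x Ix)) phif// mulr1.
  apply: is_derive_inverse; [exact: near_psiK|exact: near_cont| |exact: phi'0].
  exact/derive1_is_derive/dphi.
have dcomp h k : smooth_on I k -> (forall x, I x -> h (phi x) = k x) ->
    forall x, I x -> is_derive (phi x) 1 h (derive1 k x * f x).
  move=> sk hk x Ix.
  have dk : is_derive (psi (phi x)) 1 k (derive1 k x).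
    rewrite psiK//; exact: derive1_is_derive (smooth_on_derivable sk Ix).
  apply: near_eq_is_derive (is_derive1_comp dk (dpsi x Ix)).
  have phiIx : (phi @` I) (phi x) by exists x.
  apply: filterS (open_nbhs_nbhs (conj ophiI phiIx)) => _ [y Iy <-].
  by rewrite /= psiK// hk.
split=> //; exists psi; split => //.
apply: (@smooth_on_coind _ _ ophiI [set h | exists2 k, smooth_on I k &
  forall x, I x -> h (phi x) = k x]).
- by move=> h [k sk hk] _ [x Ix <-]; have [] := dcomp h k sk hk x Ix.
- move=> h [k sk hk]; exists (derive1 h).
    exists (derive1 k * f); first exact (smooth_onM oI (smooth_on_derive1 sk) sf).
    by move=> x Ix; rewrite (is_derive_derive1 (dcomp h k sk hk x Ix)).
  by [].
- by exists id; [exact: smooth_on_id|exact: psiK].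
Qed.

Section Coordinates.
Variables (R : realType) (I : set R) (V : set (R -> R)) (n : nat).
Variable e : 'I_n -> R -> R.
Hypotheses (oI : open I) (spaceV : vf_space I V).
Hypothesis Ve : forall i, V (e i).
Hypothesis e_free : forall c : 'I_n -> R,
  (forall x, I x -> \sum_(i < n) c i * e i x = 0) -> forall i, c i = 0.
Hypothesis e_span : forall h, V h -> exists c : 'I_n -> R,
  forall x, I x -> h x = \sum_(i < n) c i * e i x.
Implicit Types (c : 'rV[R]_n) (h k : R -> R).

Definition field_of c : R -> R := fun x => \sum_(i < n) c 0 i * e i x.

Lemma field_of_mem c : V (field_of c).
Proof. exact (vf_space_sum spaceV (fun i => c 0 i) Ve). Qed.

Lemma field_ofD c d x : field_of (c + d) x = field_of c x + field_of d x.
Proof. by rewrite -big_split; apply: eq_bigr => i _; rewrite mxE mulrDl. Qed.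

Lemma field_ofZ (a : R) c x : field_of (a *: c) x = a * field_of c x.
Proof. by rewrite mulr_sumr; apply: eq_bigr => i _; rewrite mxE mulrA. Qed.

Lemma field_of0 x : field_of 0 x = 0.
Proof. by rewrite /field_of big1// => i _; rewrite mxE mul0r. Qed.

Lemma field_of_inj c d : (forall x, I x -> field_of c x = field_of d x) -> c = d.
Proof.
move=> cd; apply/rowP => i; apply/eqP; rewrite -subr_eq0; apply/eqP.
apply: (e_free (c := fun i => c 0 i - d 0 i)) => x Ix.
have := cd x Ix; rewrite /field_of => /eqP.
rewrite -subr_eq0 -sumrB => /eqP E; rewrite -[RHS]E.
by apply: eq_bigr => j _; rewrite mulrBl.
Qed.

Lemma field_of_surj h : V h -> exists c, forall x, I x -> h x = field_of c x.
Proof.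
move=> /e_span[c hc]; exists (\row_i c i) => x /hc ->.
by apply: eq_bigr => i _; rewrite mxE.
Qed.

Lemma field_of_bracket k : (forall h, V h -> V (lie_bracket k h)) ->
  exists M : 'M[R]_n, forall c x, I x ->
    lie_bracket k (field_of c) x = field_of (c *m M) x.
Proof.
move=> kV; have /choice[r rE] i := field_of_surj (kV _ (Ve i)).
exists (\matrix_i r i) => c x Ix; rewrite lie_bracket_sumr; last first.
  by move=> i; exact (vf_space_derivable spaceV (Ve i) Ix).
under eq_bigr do rewrite rE// mulr_sumr.
rewrite exchange_big /=; apply: eq_bigr => j _.
rewrite mxE mulr_suml; apply: eq_bigr => i _.
by rewrite mxE mulrA.
Qed.

End Coordinates.

Lemma affine_pair (R : realType) (I : set R) (W V : set (R -> R)) :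
  open_interval I -> quasi_Lie_scheme I W V -> vf_dim I W 2 ->
  germ_determined I V ->
  exists f g, [/\ W f, W g, forall x, I x -> lie_bracket f g x = f x &
    exists2 x0, I x0 & f x0 != 0].
Proof.
move=> [oI iI I0] [[spaceW _] [spaceV _] WV WW _] [e [We e_free e_span]] germV.
pose e0 := e ord0; pose e1 := e ord_max.
have [We0 We1] : W e0 /\ W e1 by split; exact: We.
have sum2 (c : 'I_2 -> R) x :
    \sum_(i < 2) c i * e i x = c ord0 * e0 x + c ord_max * e1 x.
  rewrite big_ord_recl big_ord1; congr (_ + c _ * e _ x); exact: val_inj.
have [x0 Ix0 e0x0] : exists2 x0, I x0 & e0 x0 != 0.
  apply: contrapT => e00.
  pose c (i : 'I_2) : R := if i == ord0 then 1 else 0.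
  suff /(e_free c)/(_ ord0)/eqP : forall x, I x -> \sum_(i < 2) c i * e i x = 0.
    by rewrite /c eqxx oner_eq0.
  move=> x Ix; rewrite sum2 /c /= mul1r mul0r addr0.
  by apply/eqP; apply: contra_notT e00 => ?; exists x.
have [c cE] := e_span _ (WW _ _ We0 We1).
set f := lie_bracket e0 e1; have Wf : W f by exact: WW.
have {}cE x : I x -> f x = c ord0 * e0 x + c ord_max * e1 x.
  by move=> Ix; rewrite -sum2; exact: cE.
have [y0 Iy0 fy0] : exists2 y0, I y0 & f y0 != 0.
  apply: contrapT => f0.
  have [x Ix|a aE] :=
      germ_determined_centralizer oI spaceV germV (WV _ We0) (WV _ We1) Ix0 e0x0.
    by apply/eqP; apply: contra_notT f0 => ?; exists x.
  pose d (i : 'I_2) : R := if i == ord0 then - a else 1.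
  suff /(e_free d)/(_ ord_max)/eqP : forall x, I x -> \sum_(i < 2) d i * e i x = 0.
    by rewrite /d /= oner_eq0.
  by move=> x Ix; rewrite sum2 /d /= mul1r aE// mulNr addNr.
pose a := c ord0; pose b := c ord_max; pose N := a ^+ 2 + b ^+ 2.
have N0 : N != 0.
  apply: contraNneq fy0 => /eqP; rewrite paddr_eq0 ?sqr_ge0// !sqrf_eq0.
  by move=> /andP[/eqP a0 /eqP b0]; rewrite cE// -/a -/b a0 b0 !mul0r addr0.
(* [[a e0 + b e1, s e0 + t e1] = (a t - b s) [e0, e1]] *)
pose s := - b / N; pose t := a / N.
have atbs : a * t - b * s = 1.
  by rewrite /s /t mulNr mulrN opprK !mulrA -mulrDl -!expr2 divff.
pose k x := t * e1 x + 0; pose g x := s * e0 x + k x.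
have [_ _ W0 WD] := spaceW.
have Wk : W k by exact: (WD t e1 (fun=> 0)).
have Wg : W g by exact: WD.
exists f, g; split => //; last by exists y0.
have dW h x : W h -> I x -> derivable h x 1.
  by move=> Wh Ix; exact (vf_space_derivable spaceW Wh Ix).
move=> x Ix.
have fE y : I y -> f y = a * e0 y + (b * e1 y + 0) by move=> /cE ->; rewrite addr0.
have d0 : derivable (fun=> 0 : R) x 1 by exact: derivable_cst.
have f'E : derive1 f x = a * derive1 e0 x + b * derive1 e1 x.
  rewrite (derive1_eq_on oI fE)//.
  rewrite (derive1_lin _ (dW _ _ We0 Ix) (dW _ _ (WD b e1 (fun=> 0) We1 W0) Ix)).
  by rewrite (derive1_lin _ (dW _ _ We1 Ix) d0) derive1_cst addr0.
have g'E : derive1 g x = s * derive1 e0 x + t * derive1 e1 x.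
  rewrite (derive1_lin _ (dW _ _ We0 Ix) (dW _ _ Wk Ix)).
  by rewrite (derive1_lin _ (dW _ _ We1 Ix) d0) derive1_cst addr0.
rewrite -[LHS]/(f x * derive1 g x - g x * derive1 f x) f'E g'E {1}fE//.
rewrite -[RHS]mul1r -atbs -[f x]/(e0 x * derive1 e1 x - e1 x * derive1 e0 x).
rewrite -[g x]/(s * e0 x + (t * e1 x + 0)).
by move: (derive1 e0 x) (derive1 e1 x) => *; ring.
Qed.

Lemma quasi_Lie_straightening (R : realType) (q : nat) (I : set R)
    (V : set (R -> R)) (f g : R -> R) (x0 : R) :
  (3 <= q)%N -> open_interval I -> vf_space I V -> vf_dim I V q.+1 ->
  germ_determined I V -> V f -> V g ->
  (forall h, V h -> V (lie_bracket f h)) ->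
  (forall h, V h -> V (lie_bracket g h)) ->
  (forall x, I x -> lie_bracket f g x = f x) -> I x0 -> f x0 != 0 ->
  exists2 phi : R -> R, smooth_on I phi &
    (forall x, I x -> derive1 phi x * f x = 1) /\ V `<=` poly_fields I phi f q.+1.
Proof.
move=> q3 [oI iI I0] spaceV [e [Ve e_free e_span]] germV Vf Vg fV gV fg Ix0 fx0.
pose ev := field_of e.
have evV c : V (ev c) by exact (field_of_mem spaceV Ve c).
have ev_inj c d : (forall x, I x -> ev c x = ev d x) -> c = d.
  exact: field_of_inj.
have sV h : V h -> smooth_on I h by case: spaceV => + _ _ _; apply.
have dV h x : V h -> I x -> derivable h x 1.
  by move=> Vh Ix; exact: smooth_on_derivable (sV h Vh) x Ix.
have ddV h x : V h -> I x -> derivable (derive1 h) x 1.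
  by move=> Vh Ix; exact: smooth_on_derivable (smooth_on_derive1 (sV h Vh)) x Ix.
have ev0 x : ev 0 x = 0 by exact: field_of0.
have evD c d x : ev (c + d) x = ev c x + ev d x by exact: field_ofD.
have evZ a c x : ev (a *: c) x = a * ev c x by exact: field_ofZ.
have [A AE] : exists A : 'M[R]_q.+1, forall c x, I x ->
    lie_bracket f (ev c) x = ev (c *m A) x := field_of_bracket spaceV Ve e_span fV.
have [B BE] : exists B : 'M[R]_q.+1, forall c x, I x ->
    lie_bracket g (ev c) x = ev (c *m B) x := field_of_bracket spaceV Ve e_span gV.
have evS h : V h -> exists c, forall x, I x -> h x = ev c x.
  exact: field_of_surj.
have [cf cfE] := evS f Vf.
have [cg cgE] := evS g Vg.
clearbody ev; clear e Ve e_free e_span.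
have brf h : forall x, I x -> lie_bracket h f x = lie_bracket h (ev cf) x.
  by move=> x Ix; exact (lie_bracket_eq_on oI (fun y _ => erefl (h y)) cfE Ix).
have brg h : forall x, I x -> lie_bracket h g x = lie_bracket h (ev cg) x.
  by move=> x Ix; exact (lie_bracket_eq_on oI (fun y _ => erefl (h y)) cgE Ix).
have lie_bracketxx h x : lie_bracket h h x = 0 :> R by exact: subrr.
have cfA : cf *m A = 0.
  apply: ev_inj => x Ix; rewrite -AE// -brf// lie_bracketxx.
  by rewrite ev0.
have cgA : cg *m A = cf by apply: ev_inj => x Ix; rewrite -AE// -brg// fg// cfE.
have cgB : cg *m B = 0.
  apply: ev_inj => x Ix; rewrite -BE// -brg// lie_bracketxx.
  by rewrite ev0.
have cfB : cf *m B = - cf.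
  apply: ev_inj => x Ix; rewrite -BE// -brf// lie_bracketC.
  by rewrite -(scaleN1r cf) evZ mulN1r -cfE// -fg.
have cf0 : cf != 0.
  apply: contraNneq fx0 => cf0; rewrite cfE// cf0.
  by rewrite ev0.
have kerA c : c *m A = 0 -> exists a, c = a *: cf.
  move=> cA; have fc0 x : I x -> lie_bracket f (ev c) x = 0.
    move=> Ix; rewrite AE// cA.
    by rewrite ev0.
  have [a aE] := germ_determined_centralizer oI spaceV germV Vf (evV c) Ix0 fx0 fc0.
  by exists a; apply: ev_inj => x Ix; rewrite aE// cfE// evZ.
have BA : B * A = A * B + A.
  suff BAc (c : 'rV_q.+1) : c *m (B *m A) = c *m (A *m B + A).
    by apply/row_matrixP => i; rewrite !rowE; exact: BAc.
  rewrite mulmxDr !mulmxA; apply: ev_inj => x Ix.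
  have eB y : I y -> lie_bracket g (ev c) y = ev (c *m B) y by exact: BE.
  have eA y : I y -> lie_bracket f (ev c) y = ev (c *m A) y by exact: AE.
  have id_on h y : I y -> h y = h y :> R by [].
  rewrite evD -AE// -BE// -eA//.
  rewrite -(lie_bracket_eq_on oI (id_on f) eB Ix).
  rewrite -(lie_bracket_eq_on oI (id_on g) eA Ix).
  rewrite -(lie_bracket_eq_on oI fg (id_on (ev c)) Ix) addrC.
  apply: lie_bracket_jacobi; by [exact: dV|exact: ddV].
have Anil : A ^+ q.+1 = 0 by apply: nilpotent_of_comm BA; exact: pchar_num.
have rA : \rank A = q.
  have kerE : (kermx A :=: cf)%MS.
    apply/eqmxP; apply/andP; split; last exact/sub_kermxP.
    apply/row_subP => i; have /kerA[a ->] : row i (kermx A) *m A = 0.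
      by rewrite -row_mul mulmx_ker row0.
    exact: scalemx_sub.
  have := mxrank_ker A; rewrite kerE rank_rV cf0; have := rank_leq_row A; lia.
have imA := submx_of_mulmx_exp Anil rA.
have Aq (c : 'rV_q.+1) : c *m A *m A *m A = 0 -> c *m A ^+ q = 0.
  move=> c3; have -> : A ^+ q = A * (A * A) * A ^+ (q - 3).
    by rewrite -[A * (A * A)]/(A ^+ 3) -exprD subnKC.
  by rewrite -!mulmxE !mulmxA c3 !mul0mx.
have [c2 c2A] : exists c2, c2 *m A = 2 *: cg.
  have /submxP[c ->] : (2 *: cg <= A)%MS; last by exists c.
  by apply/imA/Aq; rewrite -!scalemxAl cgA cfA mul0mx scaler0.
have [b bE] : exists b, c2 *m B - c2 = b *: cf.
  apply: kerA; rewrite mulmxBl -!mulmxA mulmxE BA mulmxDr addrK -mulmxE mulmxA.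
  by rewrite c2A -scalemxAl cgB scaler0.
pose d2 := c2 + (b / 2) *: cf.
have d2A : d2 *m A = 2 *: cg by rewrite mulmxDl -scalemxAl cfA scaler0 addr0.
have d2B : d2 *m B = d2.
  apply/eqP; rewrite -subr_eq0 mulmxDl -scalemxAl cfB opprD addrACA bE scalerN.
  by rewrite -opprD -scalerDl -splitr subrr.
have [d3 d3A] : exists d3, d3 *m A = 3 *: d2.
  have /submxP[c ->] : (3 *: d2 <= A)%MS; last by exists c.
  by apply/imA/Aq; rewrite -!scalemxAl d2A -!scalemxAl cgA cfA !scaler0.
have f0 x : I x -> f x != 0.
  move=> Ix; apply: contraNneq fx0 => fx; apply/eqP; refine (germV f x Vf Ix _ x0 Ix0).
  refine (lie_bracket_vanishing oI (sV _ Vf) (sV _ Vg) (sV _ (evV d2))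
    (sV _ (evV d3)) fg _ _ _ Ix fx).
  - by move=> y Iy; rewrite AE// d2A evZ cgE.
  - by move=> y Iy; rewrite BE// d2B.
  - by move=> y Iy; rewrite AE// d3A evZ.
pose phi x := g x * (f x)^-1.
have sphi : smooth_on I phi := smooth_onM oI (sV g Vg) (smooth_onV oI (sV f Vf) f0).
exists phi => //.
have phif x : I x -> derive1 phi x * f x = 1.
  move=> Ix; have f'V := derive1V (f0 x Ix) (dV _ _ Vf Ix).
  have dVf : derivable (fun y => (f y)^-1) x 1.
    by apply: derivableV; [exact: f0|exact: dV].
  have -> := derive1M (dV _ _ Vg Ix) dVf : derive1 phi x = _.
  have := fg x Ix; rewrite f'V /lie_bracket.
  have := f0 x Ix; move: (f x) (g x) (derive1 f x) (derive1 g x) => a c f1 g1 a0 aE.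
  transitivity ((a * g1 - c * f1) / a); first by field.
  by rewrite aE divff.
have dphi x : I x -> derivable phi x 1 := @smooth_on_derivable _ _ _ sphi x.
split=> // h /evS[c hE].
suff main m d : d *m A ^+ m = 0 -> poly_fields I phi f m (ev d).
  have [|p sp pE] := main q.+1 c; first by rewrite Anil mulmx0.
  by exists p => // x Ix; rewrite hE// pE.
elim: m d => [|m IH] d dA.
  exists 0; first by rewrite size_poly0.
  move=> x _; rewrite horner0 mul0r -(ev0 x); congr (ev _ x).
  by rewrite -dA expr0 mulmx1.
have [p sp pE] : poly_fields I phi f m (ev (d *m A)).
  by apply: IH; rewrite -mulmxA mulmxE -exprS.
have [r sr rE] := deriv_surjective sp.
pose k y := r.[phi y] * f y.
have dk x : I x -> derivable k x 1.
  move=> Ix; have [drphi _] := is_derive_horner_comp r (dphi x Ix).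
  exact: derivableM drphi (dV _ _ Vf Ix).
have fk x : I x -> lie_bracket f k x = p.[phi x] * f x.
  move=> Ix; have f1 y : I y -> f y = (1 : {poly R}).[phi y] * f y.
    by rewrite hornerC mul1r.
  have kk y : I y -> k y = r.[phi y] * f y by [].
  rewrite (lie_bracket_eq_on oI f1 kk Ix).
  rewrite (lie_bracket_horner _ _ (dphi x Ix) (dV _ _ Vf Ix) (phif x Ix)).
  by rewrite mul1r rE -[1]/(1%:P) derivC mulr0 subr0.
have [|x Ix|x Ix|x Ix|x Ix|a aE] := @lie_bracket_eq0 R I f (ev d - k) iI.
- by exists x0.
- exact: dV.
- by apply: derivableB; [exact: dV|exact: dk].
- exact: f0.
- by rewrite lie_bracketBr ?fk ?AE ?pE ?subrr//; [exact: dV|exact: dk].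
exists (r + a%:P).
  rewrite (leq_trans (size_polyD _ _))// geq_max sr.
  exact: leq_trans (size_polyC_leq1 _) _.
move=> x Ix; have /eqP := aE x Ix; rewrite subr_eq => /eqP ->.
by rewrite hornerD hornerC mulrDl addrC.
Qed.

Theorem theorem5p2 (R : realType) (q : nat) (I : set R) (X : R -> R -> R)
    (hq : (3 <= q)%N) (hI : open_interval I) :
  abel_up_to_change q I X <->
  exists W V : set (R -> R),
    [/\ quasi_Lie_scheme I W V, vf_dim I W 2, vf_dim I V q.+1,
        germ_determined I V & quasi_Lie_family V X].
Proof.
split; first exact: abel_quasi_Lie.
move=> [W [V [scheme dimW dimV germV VX]]].
have [f [g [Wf Wg fg [x0 Ix0 fx0]]]] := affine_pair hI scheme dimW germV.
have [_ [spaceV _] WV _ WVV] := scheme.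
have [phi sphi [phif Vphi]] := quasi_Lie_straightening hq hI spaceV dimV germV
  (WV _ Wf) (WV _ Wg) (fun h => WVV f h Wf) (fun h => WVV g h Wg) fg Ix0 fx0.
have [oI iI _] := hI.
have sf : smooth_on I f by case: spaceV => + _ _ _; apply; exact: WV.
have /choice[p pP] t : exists p : {poly R}, (size p <= q.+1)%N /\
    forall x, I x -> X t x = p.[phi x] * f x.
  by have [p sp pE] := Vphi _ (VX t); exists p.
exists phi, (fun t y => (p t).[y]); split.
- exact: smooth_local_diffeo sphi sf phif.
- move=> t x Ix; have [_ ->//] := pP t.
  by rewrite mulrCA phif// mulr1.
- exists (fun i t => (p t)`_i) => t x.
  by rewrite (@horner_coef_wide _ q.+1)//; have [] := pP t.
Qed.
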